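(* Let $\mathcal{P}$ be the set of all integer partitions and $\mathcal{P}_{\square}$ the set of partitions whose parts are all perfect squares. Then there is a (natural) bijection between $\mathcal{P}_{\square}$ and $\mathcal{P}$. Moreover, for every integer $n\geq 0$, the number of partitions $\lambda\in\mathcal{P}_{\square}$ with $\mathcal{L}(\lambda)=n$ is equal to $p(n)$, the number of partitions of $n$.
   Context: A partition is a finite multiset of positive integers (its parts), equivalently a finite weakly decreasing sequence of positive integers; it is a partition of $n$ if its parts sum to $n$. The number of partitions of $n\geq 0$ is $p(n)$, with $p(0):=1$ (the empty partition, which is regarded as belonging to both $\mathcal{P}$ and $\mathcal{P}_{\square}$). The perfect squares here are the positive ones $1^2,2^2,3^2,\dots$. A partition $\lambda\in\mathcal{P}_{\square}$ is written in frequency notation as $\lambda=\left((1^2)^{e_1}\ (2^2)^{e_2}\ (3^2)^{e_3}\cdots(i^2)^{e_i}\cdots\right)$, where $e_i\geq 0$ is the number of times $i^2$ occurs as a part of $\lambda$ (only finitely many $e_i$ are nonzero). The statistic $\mathcal{L}$ on $\mathcal{P}_{\square}$ is defined by $$\mathcal{L}(\lambda)=\sum_{i\geq 1} i\cdot e_i.$$ The word ''natural'' is informal and carries no technical meaning. *)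

(* Defs.v *)
From HB Require Import structures.
From mathcomp Require Import all_boot finmap.
From mathcomp Require Import boolp classical_sets functions cardinality fsbigop.

Set Implicit Arguments.
Unset Strict Implicit.
Unset Printing Implicit Defensive.

Local Open Scope classical_set_scope.

Definition is_intpart (s : seq nat) : bool :=
  sorted geq s && all (fun m => 0 < m) s.

Record intpart : Type := IntPart {
  parts :> seq nat;
  _ : is_intpart parts
}.

HB.instance Definition _ := [isSub for parts].
HB.instance Definition _ := [Choice of intpart by <:].

Definition weight (l : intpart) : nat := sumn l.

Definition partitions_of (n : nat) : set intpart :=
  [set l | weight l = n].

Lemma size_intpart (l : intpart) : size l <= weight l.
Proof.
have /andP[_] := valP l; rewrite /weight /=.
elim: (parts l) => //= m s IHs /andP[m_gt0 /IHs s_le].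
by rewrite -add1n leq_add.
Qed.

Lemma intpart_le (l : intpart) m : m \in parts l -> m <= weight l.
Proof.
rewrite /weight; elim: (parts l) => //= k s IHs.
rewrite inE => /predU1P[->|/IHs]; first exact: leq_addr.
by move=> /leq_trans; apply; exact: leq_addl.
Qed.

(* fset_set sends every infinite set to fset0, so p and the counts by L below
   are meaningful only because the sets they count are finite. *)
Lemma finite_partitions_of n : finite_set (partitions_of n).
Proof.
pose g (b : n.-bseq 'I_n.+1) : intpart :=
  insubd (IntPart (isT : is_intpart [::])) [seq val i | i <- b].
apply: sub_finite_set (finite_image g (@finite_finset _ setT)) => l wl.
have szl : size [seq inord m : 'I_n.+1 | m <- parts l] <= n.
  by rewrite size_map -wl size_intpart.
exists (Bseq szl) => //; apply: val_inj; rewrite /g.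
have -> : [seq val i | i <- Bseq szl] = parts l.
  rewrite /= -map_comp map_id_in // => m /intpart_le.
  by rewrite wl => mn /=; rewrite inordK.
by rewrite val_insubd (valP l).
Qed.

Definition p (n : nat) : nat := #|` fset_set (partitions_of n)|%fset.

Definition square_partitions : set intpart :=
  [set l | forall m, m \in parts l -> exists2 i, 0 < i & m = i ^ 2].

Definition freq (l : intpart) (i : nat) : nat := count_mem (i ^ 2) (parts l).

(* The sum ranges over all i >= 1; the summand has finite support, so the
   finitely supported big operator is the infinite sum. *)
Definition L (l : intpart) : nat :=
  \big[addn/0%N]_(i \in [set i : nat | 0 < i]) (i * freq l i).

(* Main.v *)
Require Import Defs.
From mathcomp Require Import all_boot finmap.
From mathcomp Require Import boolp classical_sets functions cardinality fsbigop.

(** Squaring every part of a partition, [square_parts], keeps the parts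
    positive and weakly decreasing, because squaring is strictly increasing on
    the natural numbers. For the same reason the resulting partition determines
    the original one, and every partition into positive squares arises this
    way ([square_partitionsE]): take the square root of each part. Taking roots,
    [root_parts], is therefore a bijection from the partitions into squares to
    all partitions ([root_parts_bij]).

    The statistic [L] counts each part i ^ 2 with the value i, so on a partition
    into squares it is the sum of the roots of the parts, that is
    L (square_parts l) = weight l ([L_square_parts]). Hence squaring maps the
    partitions of n injectively onto the partitions into squares with L = n, and
    the two finite sets have the same cardinality. *)

Local Open Scope classical_set_scope.

Lemma sqn_inj : injective (fun i => i ^ 2).
Proof. by move=> i j /eqP; rewrite eqn_exp2r // => /eqP. Qed.

(** The square root on perfect squares, as the position of the argument in the
    list of the first squares: a root of m is at most m, and [0 .. m] has m + 1
    elements. *)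
Definition sqrtn (m : nat) : nat := index m [seq i ^ 2 | i <- iota 0 m.+1].

Lemma sqnK : cancel (fun i => i ^ 2) sqrtn.
Proof.
move=> i; have i_lt : i < (i ^ 2).+1 by rewrite ltnS; case: i => // i; exact: leq_pmull.
apply: etrans (index_map sqn_inj (iota 0 (i ^ 2).+1) i) _.
by rewrite -[X in index X](nth_iota 0 0 i_lt) index_uniq ?iota_uniq ?size_iota.
Qed.

Lemma is_intpart_sqn (s : seq nat) :
  is_intpart [seq i ^ 2 | i <- s] = is_intpart s.
Proof.
rewrite /is_intpart sorted_map all_map; congr (_ && _).
  by apply: eq_sorted => i j; rewrite /= leq_exp2r.
by apply: eq_all => i; rewrite /= expn_gt0 orbF.
Qed.

Lemma square_parts_subproof (l : intpart) :
  is_intpart [seq i ^ 2 | i <- parts l].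
Proof. by rewrite is_intpart_sqn (valP l). Qed.

Definition square_parts (l : intpart) : intpart :=
  IntPart (square_parts_subproof l).

(** The empty partition is the default value, taken only when the sequence of
    roots is not a partition, which never happens on partitions into squares. *)
Definition root_parts (l : intpart) : intpart :=
  insubd (IntPart (isT : is_intpart [::])) [seq sqrtn m | m <- parts l].

Lemma square_partsK : cancel square_parts root_parts.
Proof.
move=> l; apply: val_inj; rewrite /root_parts val_insubd /= (mapK sqnK).
by rewrite (valP l).
Qed.

(** Only the inclusion from left to right has content: since squaring reflects
    order and positivity, the roots of the parts of a partition into squares
    form a partition again. *)
Lemma square_partitionsE : square_partitions = range square_parts.
Proof.
apply/seteqP; split=> [l sq_l|_ [l _ <-] m /mapP[i i_l ->]]; last first.
  by exists i => //; have /andP[_ /allP] := valP l; apply.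
have rootK : [seq i ^ 2 | i <- [seq sqrtn m | m <- parts l]] = parts l.
  by rewrite -map_comp map_id_in // => m /sq_l[i _ ->] /=; rewrite sqnK.
have root_l : is_intpart [seq sqrtn m | m <- parts l].
  by rewrite -is_intpart_sqn rootK (valP l).
by exists (IntPart root_l) => //; apply: val_inj.
Qed.

Lemma root_parts_bij : set_bij square_partitions [set: intpart] root_parts.
Proof.
rewrite square_partitionsE; split=> //.
  move=> _ _ /set_mem[l _ <-] /set_mem[l' _ <-].
  by rewrite !square_partsK => ->.
by move=> l _; exists (square_parts l); [exists l | exact: square_partsK].
Qed.

(** Grouping equal entries turns a sum over the entries, such as [weight], into
    a sum over all values, such as [L]. Zero entries do no harm, as they add
    nothing to either side. *)
Lemma sumn_count_mem (s : seq nat) :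
  \big[addn/0%N]_(i \in [set i : nat | 0 < i]) (i * count_mem i s) = sumn s.
Proof.
rewrite (fsbig_widen _ setT) //; last first.
  by move=> [|i] [_ /=]; rewrite ?mul0n // => /(_ isT).
rewrite (fsbigE (undup s)) ?undup_uniq //; last first.
  move=> i _; rewrite mem_undup => /count_memPn ->; exact: muln0.
rewrite sumnE -[RHS]big_undup_iterop_count.
by apply: eq_big => i; rewrite ?in_setT // Monoid.iteropE iter_addn_0.
Qed.

Lemma L_square_parts (l : intpart) : L (square_parts l) = weight l.
Proof.
rewrite /weight -sumn_count_mem; apply: eq_fsbigr => i _.
rewrite /freq /= count_map; congr (_ * _); apply: eq_count => j /=.
by rewrite (inj_eq sqn_inj).
Qed.

Lemma square_partitions_LE (n : nat) :
  [set l | square_partitions l /\ L l = n] = square_parts @` partitions_of n.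
Proof.
rewrite square_partitionsE; apply/seteqP; split=> [_ [[l _ <-]]|_ [l wl <-]].
  by rewrite L_square_parts => wl; exists l.
by split; [exists l | rewrite L_square_parts].
Qed.

Theorem corollary1p3 :
  (exists f : intpart -> intpart, set_bij square_partitions [set: intpart] f) /\
  (forall n : nat,
     finite_set [set l | square_partitions l /\ L l = n] /\
     #|` fset_set [set l | square_partitions l /\ L l = n]|%fset = p n).
Proof.
split; first by exists root_parts; exact: root_parts_bij.
move=> n; have fin_n := finite_partitions_of n; rewrite square_partitions_LE.
split; first exact: finite_image.
by rewrite fset_set_image // card_imfset //; exact: can_inj square_partsK.
Qed.
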